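(* Let $\mathbb{K}$ be a commutative ring with identity and let $(A,[-,-])$ be a Lie $\mathbb{K}$-affgebra. Then, for all $o\in A$, the $\mathbb{K}$-module $A_o$ together with the bracket $$[a,b]_{o}= \langle [a,b],[a,o],[o,o],[o,b],o \rangle = [a,b]-[a,o]+[o,o]-[o,b],\qquad a,b\in A_o,$$ (where $+$ and $-$ are the operations of the $\mathbb{K}$-module $A_o$) is a Lie $\mathbb{K}$-algebra. Furthermore, for any $o,u\in A$, the Lie $\mathbb{K}$-algebras $(A_o,[-,-]_o)$ and $(A_u,[-,-]_u)$ are isomorphic.
   Context: An abelian heap is a set $A$ with a ternary operation $\langle -,-,-\rangle:A^3\to A$ such that for all $a,b,c,d,e\in A$: $\langle\langle a,b,c\rangle,d,e\rangle=\langle a,b,\langle c,d,e\rangle\rangle$, $\langle a,b,b\rangle=a=\langle b,b,a\rangle$, $\langle a,b,c\rangle=\langle c,b,a\rangle$. Heap homomorphisms are maps preserving the ternary operation. One writes $\langle a_1,\ldots,a_{2n+1}\rangle:=\langle\ldots\langle\langle a_1,a_2,a_3\rangle,a_4,a_5\rangle,\ldots,a_{2n+1}\rangle$. An affine $\mathbb{K}$-module ($\mathbb{K}$ a commutative ring with identity) is a non-empty abelian heap $A$ with a map $\mathbb{K}\times A\times A\to A$, $(\alpha,a,b)\mapsto\alpha\triangleright_a b$, such that for all $a,b,c\in A$, $\alpha,\beta\in\mathbb{K}$: (a) $\alpha\triangleright_a-:A\to A$ and $-\triangleright_a b:\mathbb{K}\to A$ are heap homomorphisms, where $\mathbb{K}$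 is a heap via $\alpha-\beta+\gamma$; (b) $(\alpha\beta)\triangleright_a b=\alpha\triangleright_a(\beta\triangleright_a b)$; (c) $\alpha\triangleright_a b=\langle\alpha\triangleright_c b,\alpha\triangleright_c a,a\rangle$; (d) $0\triangleright_a b=a$ and $1\triangleright_a b=b$. A homomorphism of affine $\mathbb{K}$-modules (affine map) is a heap homomorphism $f$ with $f(\alpha\triangleright_a b)=\alpha\triangleright_{f(a)}f(b)$. A map $A\times A\to A$ is bi-affine if it is an affine map in each argument separately. For $o\in A$, $A_o$ denotes the $\mathbb{K}$-module with underlying set $A$, addition $a+b=\langle a,o,b\rangle$, zero $o$ and scalar multiplication $\alpha a=\alpha\triangleright_o a$. A Lie bracket on an affine $\mathbb{K}$-module $A$ (by convention, a left Lie bracket) is a bi-affine map $[-,-]:A\times A\to A$ such that for all $a,b,c\in A$: $\langle [a,b],[a,a],[b,a]\rangle=[b,b]$ and $\langle [a,[b,c]],[a,a],[b,[c,a]],[b,b],[c,[a,b]]\rangle=[c,c]$. An affine $\mathbb{K}$-module with a Lie bracket is called a Lie $\mathbb{K}$-affgebra. *)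

(* Defs.v *)
From HB Require Import structures.
From mathcomp Require Import all_boot all_algebra.

Set Implicit Arguments.
Unset Strict Implicit.
Unset Printing Implicit Defensive.

Import GRing.Theory.
Local Open Scope ring_scope.

(* [heap_morph tA tB f]: f is a homomorphism from (A, tA) to (B, tB). The
   ternary operations are explicit so that a ring can be used as a heap through
   x - y + z without being given a second canonical structure. *)
Definition heap_morph (A B : Type) (tA : A -> A -> A -> A)
    (tB : B -> B -> B -> B) (f : A -> B) : Prop :=
  forall x y z, f (tA x y z) = tB (f x) (f y) (f z).

HB.mixin Record isAbelianHeap A := {
  heap : A -> A -> A -> A;
  heapA : forall a b c d e, heap (heap a b c) d e = heap a b (heap c d e);
  heap_idr : forall a b, heap a b b = a;
  heap_idl : forall a b, heap b b a = a;
  heapC : forall a b c, heap a b c = heap c b a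
}.

#[short(type="abHeapType")]
HB.structure Definition AbelianHeap := {A of Choice A & isAbelianHeap A}.

Definition heap5 (A : abHeapType) (a b c d e : A) : A :=
  heap (heap a b c) d e.

(* [act al a b] is the action of the scalar al on b with base point a. *)
HB.mixin Record isAffineModule (K : comPzRingType) A of AbelianHeap A := {
  aff_nonempty : inhabited A;
  act : K -> A -> A -> A;
  act_heapr : forall al a, heap_morph (@heap A) (@heap A) (act al a);
  act_heapl : forall a b,
    heap_morph (fun x y z : K => x - y + z) (@heap A) (fun al => act al a b);
  actM : forall (al be : K) a b, act (al * be) a b = act al a (act be a b);
  act_base : forall al a b c, act al a b = heap (act al c b) (act al c a) a;
  act0 : forall a b, act 0 a b = a;
  act1 : forall a b, act 1 a b = b
}.

#[short(type="affModType")]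
HB.structure Definition AffineModule (K : comPzRingType) :=
  {A of AbelianHeap A & isAffineModule K A}.

Definition affine_map (K : comPzRingType) (A B : affModType K) (f : A -> B) :
    Prop :=
  heap_morph heap heap f /\
  forall (al : K) a b, f (act al a b) = act al (f a) (f b).

Definition biaffine_map (K : comPzRingType) (A : affModType K)
    (f : A -> A -> A) : Prop :=
  (forall a, affine_map (f a)) /\ (forall b, affine_map (fun a => f a b)).

HB.mixin Record hasLieBracket (K : comPzRingType) A of AffineModule K A := {
  brk : A -> A -> A;
  brk_biaffine : biaffine_map brk;
  brk_anti : forall a b, heap (brk a b) (brk a a) (brk b a) = brk b b;
  brk_jacobi : forall a b c,
    heap5 (brk a (brk b c)) (brk a a) (brk b (brk c a)) (brk b b)
      (brk c (brk a b)) = brk c c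
}.

#[short(type="lieAffgebraType")]
HB.structure Definition LieAffgebra (K : comPzRingType) :=
  {A of AffineModule K A & hasLieBracket K A}.

(* The module A_o: an alias of A, so that each base point o carries its own
   canonical module structure. *)
Definition based (K : comPzRingType) (A : affModType K) (o : A) : Type := A.

Section Based.
Variables (K : comPzRingType) (A : affModType K) (o : A).
Implicit Types a b c : based o.

Definition based_add a b : based o := heap (a : A) o (b : A).
Definition based_opp a : based o := heap o (a : A) o.
Definition based_scale (al : K) a : based o := act al o (a : A).

Fact based_addA : associative based_add.
Proof. by move=> a b c; rewrite /based_add heapA. Qed.

Fact based_addC : commutative based_add.
Proof. by move=> a b; rewrite /based_add heapC. Qed.

Fact based_add0 : left_id (o : based o) based_add.
Proof. by move=> a; rewrite /based_add heap_idl. Qed.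

Fact based_addN : left_inverse (o : based o) based_opp based_add.
Proof. by move=> a; rewrite /based_add /based_opp heapA heap_idl heap_idr. Qed.

HB.instance Definition _ := Choice.on (based o).
HB.instance Definition _ := GRing.isZmodule.Build (based o)
  based_addA based_addC based_add0 based_addN.

Fact based_scaleA (al be : K) a :
  based_scale al (based_scale be a) = based_scale (al * be) a.
Proof. by rewrite /based_scale actM. Qed.

Fact based_scale1 : left_id 1 based_scale.
Proof. by move=> a; rewrite /based_scale act1. Qed.

Fact based_scaleDr : right_distributive based_scale +%R.
Proof.
have act_oo (al : K) : act al o o = o by rewrite (act_base al o o o) heap_idl.
by move=> al a b; rewrite /based_scale /GRing.add /= /based_add act_heapr act_oo.
Qed.

Fact based_scaleDl a : {morph based_scale^~ a : al be / al + be}.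
Proof.
move=> al be; rewrite -{1}(subr0 al) /based_scale.
by rewrite (act_heapl o (a : A) al 0 be) act0.
Qed.

HB.instance Definition _ := GRing.Zmodule_isLmodule.Build K (based o)
  based_scaleA based_scale1 based_scaleDr based_scaleDl.

End Based.

Definition based_bracket (K : comPzRingType) (A : lieAffgebraType K) (o : A)
    (a b : based o) : based o :=
  heap5 (brk (a : A) (b : A)) (brk (a : A) o) (brk o o) (brk o (b : A)) o.

Definition lie_algebra (K : comPzRingType) (V : lmodType K)
    (br : V -> V -> V) : Prop :=
  [/\ (forall x, linear (br x)),
      (forall y, linear (fun x => br x y)),
      (forall x, br x x = 0)
    & (forall x y z, br x (br y z) + br y (br z x) + br z (br x y) = 0)].

Definition lie_isomorphic (K : comPzRingType) (V W : lmodType K)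
    (brV : V -> V -> V) (brW : W -> W -> W) : Prop :=
  exists f : {linear V -> W},
    bijective f /\ forall x y, f (brV x y) = brW (f x) (f y).

(* Main.v *)
(** In the module A_o the bracket [-,-]_o is the mixed second difference of the
    bi-affine map [-,-], so it is bilinear, and it is alternating by
    antisymmetry at (a, o). Likewise [a,[b,c]_o]_o is the mixed third difference
    of (a, b, c) |-> [a,[b,c]]. Third differences are additive and invariant
    under permuting the variables, so the Jacobi sum is the third difference of
    [a,[b,c]] + [b,[c,a]] + [c,[a,b]] = [a,a] + [b,b] + [c,c], which vanishes
    because no summand depends on all three variables. The isomorphism from
    A_o to A_u is the translation x |-> <x,o,u>. *)

Require Import Defs.
From HB Require Import structures.
From mathcomp Require Import all_boot all_algebra.

Set Implicit Arguments.
Unset Strict Implicit.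
Unset Printing Implicit Defensive.

Import GRing.Theory.
Local Open Scope ring_scope.

Section Differences.
Variable V : zmodType.
Implicit Types x y z t : V.

Lemma subrDD x y z t : (x + y) - (z + t) = (x - z) + (y - t).
Proof. by rewrite opprD addrACA. Qed.

Lemma subrBB x y z t : (x - y) - (z - t) = (x - z) - (y - t).
Proof. by rewrite !opprB [t - z]addrC addrACA [- y + t]addrC. Qed.

Definition diff2 (F : V -> V -> V) a b := (F a b - F a 0) - (F 0 b - F 0 0).

Lemma diff2D F G a b :
  diff2 (fun a b => F a b + G a b) a b = diff2 F a b + diff2 G a b.
Proof. by rewrite /diff2 (subrDD (F a b)) (subrDD (F 0 b)) subrDD. Qed.

Definition diff3 (F : V -> V -> V -> V) a b c :=
  diff2 (F a) b c - diff2 (F 0) b c.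

Lemma diff3D F G a b c :
  diff3 (fun a b c => F a b c + G a b c) a b c = diff3 F a b c + diff3 G a b c.
Proof. by rewrite /diff3 (diff2D (F a) (G a)) (diff2D (F 0) (G 0)) subrDD. Qed.

(** Differences in distinct variables commute: each [subrBB] exchanges the order of two of them. *)
Lemma diff3_rot F a b c : diff3 F b c a = diff3 (fun a b c => F b c a) a b c.
Proof.
rewrite /diff3 /diff2 (subrBB (F b c a)) (subrBB (F 0 c a)).
by rewrite (subrBB (F b c a - _)).
Qed.

Lemma eq_diff3 F G a b c :
  (forall a b c, F a b c = G a b c) -> diff3 F a b c = diff3 G a b c.
Proof. by move=> eqFG; rewrite /diff3 /diff2 !eqFG. Qed.

Lemma diff3_const1 F a b c : diff3 (fun _ b c => F b c) a b c = 0.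
Proof. by rewrite /diff3 subrr. Qed.

Lemma diff3_const2 F a b c : diff3 (fun a _ c => F a c) a b c = 0.
Proof. by rewrite /diff3 /diff2 !subrr. Qed.

End Differences.

Section BasedModule.
Variables (K : comPzRingType) (A : affModType K) (o : A).
Implicit Types a b c : based o.

Lemma based0 : 0 = o :> based o. Proof. by []. Qed.

(** The middle entry need not be [o], so heap expressions formed at any base point become arithmetic
    in the one module A_o. *)
Lemma heap_based a b c : heap (a : A) b c = a - b + c :> based o.
Proof.
rewrite /GRing.add /GRing.opp /= /based_add /based_opp.
by rewrite -(heapA (a : A)) heap_idr heapA heap_idl.
Qed.

Lemma act_based al a b :
  act al (a : A) (b : A) = al *: b - al *: a + a :> based o.
Proof. by rewrite (act_base al a b o) heap_based. Qed.

(** An affine map is its linear part [g - g 0] plus the constant [g 0]; scalars meet only the linear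
    part. *)
Lemma affine_map_based (f : A -> A) (g := f : based o -> based o) :
  affine_map f ->
  forall al a b, g (al *: a + b) = al *: (g a - g 0) + g b.
Proof.
move=> [f_heap f_act] al a b.
have -> : al *: a + b = heap (act al o (a : A)) o (b : A) by [].
rewrite /g f_heap f_act heap_based act_based -/g based0.
by rewrite addrK scalerBr.
Qed.

End BasedModule.

Section BasedLie.
Variables (K : comPzRingType) (A : lieAffgebraType K) (o : A).
Implicit Types a b c : based o.

Definition based_brk a b : based o := brk (a : A) (b : A).
Local Notation B := based_brk.

Lemma based_brkPr al a b c : B a (al *: b + c) = al *: (B a b - B a 0) + B a c.
Proof. exact: (affine_map_based (brk_biaffine.1 (a : A))). Qed.

Lemma based_brkPl al a b c : B (al *: a + b) c = al *: (B a c - B 0 c) + B b c.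
Proof. exact: (affine_map_based (brk_biaffine.2 (c : A))). Qed.

Lemma based_brkDr a b c : B a (b + c) = B a b - B a 0 + B a c.
Proof. by rewrite -[b]scale1r based_brkPr !scale1r. Qed.

Lemma based_brkDl a b c : B (a + b) c = B a c - B 0 c + B b c.
Proof. by rewrite -[a]scale1r based_brkPl !scale1r. Qed.

Lemma based_brkBr a b c : B a (b - c) = B a b - B a c + B a 0.
Proof.
by rewrite addrC -scaleN1r based_brkPr scaleN1r opprB addrC addrA addrAC.
Qed.

Lemma based_bracketE a b :
  based_bracket a b = B a b - B a 0 + B 0 0 - B 0 b :> based o.
Proof. by rewrite /based_bracket /heap5 !heap_based addr0. Qed.

Lemma based_bracket_diff2 a b : based_bracket a b = diff2 B a b.
Proof. by rewrite based_bracketE /diff2 opprB addrA. Qed.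

Lemma based_bracket_linear_r a : linear (based_bracket a).
Proof.
move=> al b c; rewrite !based_bracket_diff2 /diff2 !based_brkPr.
rewrite -(addrA _ (B a c)) -(addrA _ (B 0 c)) (subrDD (al *: _)).
by rewrite -scalerBr.
Qed.

Lemma based_bracket_linear_l b : linear (fun a => based_bracket a b).
Proof.
move=> al a c; rewrite !based_bracket_diff2 /diff2 !based_brkPl.
by rewrite (subrDD (al *: _)) -scalerBr subrBB -[LHS]addrA.
Qed.

Lemma based_bracketxx a : based_bracket a a = 0.
Proof.
rewrite based_bracketE.
have <- : B a 0 - B a a + B 0 a = B 0 0.
  by rewrite -heap_based; exact: (brk_anti (a : A) o).
by rewrite addrA addrK addrA subrK subrr.
Qed.

Lemma based_bracket_diff3 a b c :
  based_bracket a (based_bracket b c) = diff3 (fun a b c => B a (B b c)) a b c.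
Proof.
(* The linear part of the affine map [B d] commutes with differences, so only the constant [B d 0]
   is left over. The outer [diff2] subtracts exactly this constant, for [d] equal to [a] and to
   [0]. *)
have B_diff2 d : B d (diff2 B b c) = diff2 (fun b c => B d (B b c)) b c + B d 0.
  rewrite /diff2 !based_brkBr; congr (_ + _).
  by rewrite (subrDD _ (B d 0)) subrr addr0.
by rewrite !based_bracket_diff2 {1}/diff2 !B_diff2 !addrK.
Qed.

Lemma based_bracket_jacobi a b c :
  based_bracket a (based_bracket b c) + based_bracket b (based_bracket c a)
    + based_bracket c (based_bracket a b) = 0.
Proof.
(* One rotation for the second summand and two for the third bring all three differences to the
   variables [a], [b], [c], where they can be added. *)
rewrite !based_bracket_diff3 [diff3 _ b c a]diff3_rot.
rewrite [diff3 _ c a b]diff3_rot [diff3 _ b c a]diff3_rot -!diff3D.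
rewrite (@eq_diff3 _ _ (fun a b c => B a a + B b b + B c c)) => [|x y z].
  rewrite !diff3D (diff3_const2 (fun a c => B a a)).
  rewrite (diff3_const1 (fun b c => B b b)) (diff3_const1 (fun b c => B c c)).
  by rewrite !addr0.
(* Read in A_o, the Jacobi axiom expresses [B z z] through the iterated brackets, [B x x] and
   [B y y]; after substitution the last two cancel. *)
have := brk_jacobi (x : A) (y : A) (z : A).
rewrite /heap5 !(heap_based (o := o)) -![brk _ _]/(B _ _) => <-.
rewrite addrA; congr (_ + _).
by rewrite [RHS]addrC [B x x + _]addrC addrA subrK addrAC subrK.
Qed.

Lemma based_bracket_lie_algebra : lie_algebra (@based_bracket K A o).
Proof.
split; [exact: based_bracket_linear_r | exact: based_bracket_linear_l
  | exact: based_bracketxx | exact: based_bracket_jacobi].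
Qed.

End BasedLie.

Section Translation.
Variables (K : comPzRingType) (A : lieAffgebraType K) (o u : A).

Definition translate (x : based o) : based u := heap (x : A) o u.

(** A_o and A_u share their carrier, so statements about A_u can be checked with the operations of
    A_o, where the translation adds the vector [u]. *)
Lemma translateE x : translate x = x + (u : based o) :> based o.
Proof. by []. Qed.

Lemma translate_linear : linear translate.
Proof.
move=> al x y.
have -> : al *: translate x + translate y
    = heap (act al u (translate x : A)) u (translate y : A) by [].
rewrite (heap_based (o := o)) (act_based (o := o)) !translateE addrK.
by rewrite scalerDr addrK addrA.
Qed.

HB.instance Definition _ :=
  GRing.isLinear.Build K (based o) (based u) _ translate translate_linear.

Lemma translate_bij : bijective translate.
Proof.
by exists (fun y : based u => heap (y : A) u o : based o) => x;
  rewrite /translate heapA heap_idl heap_idr.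
Qed.

Local Notation B := (based_brk (o := o)).

(** The mixed second difference of a bi-affine map depends only on the increments [x] and [y], not
    on the point where it is taken. Splitting [y], then [x], off the sums [y + u] and [x + u] moves
    that point from [u] to [0]. *)
Lemma translate_bracket x y :
  translate (based_bracket x y) = based_bracket (translate x) (translate y).
Proof.
rewrite {2}/based_bracket /heap5 !(heap_based (o := o)) !translateE.
rewrite -![brk _ _]/(B _ _).
rewrite !(based_brkDr _ y) addrK !based_brkDl based_bracket_diff2 /diff2.
rewrite (subrDD _ (B u u)) subrr addr0 (subrDD (B x y - B 0 y)) addrK.
by rewrite (subrBB _ (B 0 y)).
Qed.

End Translation.

Theorem theorem3p15 (K : comPzRingType) (A : lieAffgebraType K) :
  (forall o : A,
     (forall a b : based o,
        based_bracket a b =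
          (brk (a : A) (b : A) : based o) - (brk (a : A) o : based o)
            + (brk o o : based o) - (brk o (b : A) : based o))
     /\ lie_algebra (@based_bracket K A o))
  /\ (forall o u : A,
        lie_isomorphic (@based_bracket K A o) (@based_bracket K A u)).
Proof.
split=> [o | o u].
  by split; [exact: based_bracketE | exact: based_bracket_lie_algebra].
exists (@translate K A o u); split; first exact: translate_bij.
exact: translate_bracket.
Qed.
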